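(* The only totally umbilical surfaces in the pseudo-isotropic space $\mathbb{I}_{\mathrm p}^3$ are spheres of parabolic type and non-isotropic planes. That is, a connected admissible surface in $\mathbb{I}_{\mathrm p}^3$ is totally umbilical if and only if it is (an open part of) a sphere of parabolic type or a non-isotropic plane.
   Context: The pseudo-isotropic space $\mathbb{I}_{\mathrm p}^3$ is $\mathbb{R}^3$ with the degenerate inner product $\langle \mathbf u,\mathbf v\rangle_{pz}=u^1v^1-u^2v^2$. Its rigid motions are the maps $\bar x=a+x\cosh\phi+y\sinh\phi$, $\bar y=b+x\sinh\phi+y\cosh\phi$, $\bar z=c+c_1x+c_2y+z$ with $a,b,c,c_1,c_2,\phi\in\mathbb{R}$. A plane is isotropic if it contains a line parallel to the $z$-axis. A smooth surface is admissible if none of its tangent planes is isotropic. A sphere of parabolic type is a surface that is the image, under a rigid motion, of $z=\frac{1}{2p}(x^2-y^2)-\frac p2$ for some $p\neq0$. For a local parameterization $\mathbf{x}(u^1,u^2)$ of an admissible surface write $\mathbf{x}_i=\partial\mathbf{x}/\partial u^i=(x_i^1,x_i^2,x_i^3)$ and $X_{ij}=x_1^ix_2^j-x_1^jx_2^i$. The first fundamental form is $\mathrm{I}(u,v)=\langle u,v\rangle_{pz}$ on $T_qS$. The Gauss map is $$\xi^{\mathrm p}=\left(\frac{X_{23}}{X_{12}},\ \frac{X_{13}}{X_{12}},\ \frac12\left\{1-\left[\left(\frac{X_{23}}{X_{12}}\right)^2-\left(\frac{X_{13}}{X_{12}}\right)^2\right]\right\}\right).$$ The shape operator is $L_q(w)=-D_w\xi^{\mathrm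 p}$ for $w\in T_qS$ ($D$ the usual directional derivative in $\mathbb{R}^3$), a linear operator on $T_qS$; the second fundamental form is $\mathrm{II}(u,v)=\mathrm{I}(L_q(u),v)$. A point $q$ is umbilic if $\mathrm{II}=\lambda\,\mathrm{I}$ at $q$ for some $\lambda\in\mathbb{R}$, and a surface is totally umbilical if all its points are umbilic. *)

(* Defs.v *)
From HB Require Import structures.
From mathcomp Require Import all_boot all_order all_algebra.
From mathcomp Require Import all_classical all_reals all_analysis.

Set Implicit Arguments.
Unset Strict Implicit.
Unset Printing Implicit Defensive.

Import Order.TTheory GRing.Theory Num.Theory.
Import numFieldNormedType.Exports.

Local Open Scope classical_set_scope.
Local Open Scope ring_scope.

(* Coordinates are numbered from 0: for [q : 'rV[R]_3] the x-, y- and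
   z-coordinates are [q 0 0], [q 0 1], [q 0 2]; the parameters u^1, u^2 of a
   chart are [u 0 0], [u 0 1]. *)

Section PseudoIsotropicSpace.
Context {R : realType}.

Local Notation E2 := 'rV[R]_2.
Local Notation E3 := 'rV[R]_3.

Definition vec3 (a b c : R) : E3 := \row_(j < 3) nth 0 [:: a; b; c] j.

Definition pz_inner (u v : E3) : R := u 0 0 * v 0 0 - u 0 1 * v 0 1.

Definition coshR (t : R) : R := (expR t + expR (- t)) / 2.
Definition sinhR (t : R) : R := (expR t - expR (- t)) / 2.

Definition rigid_motion (a b c c1 c2 phi : R) (q : E3) : E3 :=
  vec3 (a + q 0 0 * coshR phi + q 0 1 * sinhR phi)
       (b + q 0 0 * sinhR phi + q 0 1 * coshR phi)
       (c + c1 * q 0 0 + c2 * q 0 1 + q 0 2).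

Definition is_plane (P : set E3) : Prop :=
  exists (n : E3) (d : R), n != 0 /\ P = [set q | \sum_i n 0 i * q 0 i = d].

(* Contains a line parallel to the z-axis. *)
Definition isotropic (P : set E3) : Prop :=
  exists q : E3, forall t : R, P (q + t *: vec3 0 0 1).

Definition non_isotropic_plane (P : set E3) : Prop :=
  is_plane P /\ ~ isotropic P.

Definition standard_parabolic_sphere (p : R) : set E3 :=
  [set q | q 0 2 = (2 * p)^-1 * (q 0 0 ^+ 2 - q 0 1 ^+ 2) - p / 2].

Definition parabolic_sphere (P : set E3) : Prop :=
  exists p : R, p != 0 /\
  exists a b c c1 c2 phi : R,
    P = rigid_motion a b c c1 c2 phi @` standard_parabolic_sphere p.

(* [iter_partial [:: i1; ...; ik] f] is the partial derivative of f with
   respect to the coordinates ik, ..., i1, in this order; i1 comes last. *)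
Definition iter_partial (s : seq 'I_2) (f : E2 -> E3) : E2 -> E3 :=
  foldr (fun i g => 'D_(delta_mx 0 i) g) f s.

(* C^oo on the open set V: f and all its iterated partial derivatives are
   (Frechet) differentiable at every point of V. *)
Definition smooth_on (V : set E2) (f : E2 -> E3) : Prop :=
  forall (s : seq 'I_2) (u : E2), V u -> differentiable (iter_partial s f) u.

(* x : V -> S is a local parameterization of S: a smooth immersion which is a
   homeomorphism onto an open subset of S.  Since x is continuous on V, being
   such a homeomorphism amounts to being injective and mapping open subsets of
   V to relatively open subsets of S. *)
Definition local_parameterization (S : set E3) (V : set E2) (x : E2 -> E3) :
    Prop :=
  [/\ open V,
      smooth_on V x,
      (forall u, V u -> injective ('d x u)),
      {in V &, injective x} &
      forall W : set E2, open W -> W `<=` V ->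
        exists O : set E3, open O /\ x @` W = S `&` O].

Definition smooth_surface (S : set E3) : Prop :=
  forall q, S q ->
    exists (V : set E2) (x : E2 -> E3),
      local_parameterization S V x /\ (x @` V) q.

(* T_q S, for q = x(u) *)
Definition tangent_space (x : E2 -> E3) (u : E2) : set E3 := range ('d x u).

Definition tangent_plane (x : E2 -> E3) (u : E2) : set E3 :=
  [set x u + w | w in tangent_space x u].

Definition admissible_surface (S : set E3) : Prop :=
  smooth_surface S /\
  forall (V : set E2) (x : E2 -> E3), local_parameterization S V x ->
    forall u, V u -> ~ isotropic (tangent_plane x u).

Definition minor (x : E2 -> E3) (i j : 'I_3) (u : E2) : R :=
  let x1 := 'D_(delta_mx 0 0) x u in
  let x2 := 'D_(delta_mx 0 1) x u in
  x1 0 i * x2 0 j - x1 0 j * x2 0 i.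

Definition gauss_map (x : E2 -> E3) (u : E2) : E3 :=
  let xi1 := minor x 1 2 u / minor x 0 1 u in
  let xi2 := minor x 0 2 u / minor x 0 1 u in
  vec3 xi1 xi2 (1 / 2 * (1 - (xi1 ^+ 2 - xi2 ^+ 2))).

(* D_w f at q = x(u), for w in T_q S and a map f on S read in the chart x: the
   derivative of f along the curve x(u + t v), where w = dx_u(v).  Such a v is
   unique because dx_u is injective. *)
Definition surface_derive (x f : E2 -> E3) (u : E2) (w : E3) : E3 :=
  let v : E2 := get [set v : E2 | 'd x u v = w] in 'D_v f u.

Definition shape_operator (x : E2 -> E3) (u : E2) (w : E3) : E3 :=
  - surface_derive x (gauss_map x) u w.

Definition second_form (x : E2 -> E3) (u : E2) (w1 w2 : E3) : R :=
  pz_inner (shape_operator x u w1) w2.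

(* Umbilicity does not depend on the chart around q; all charts are allowed. *)
Definition umbilic (S : set E3) (q : E3) : Prop :=
  forall (V : set E2) (x : E2 -> E3) (u : E2),
    local_parameterization S V x -> V u -> x u = q ->
    exists lambda : R, forall w1 w2 : E3,
      tangent_space x u w1 -> tangent_space x u w2 ->
      second_form x u w1 w2 = lambda * pz_inner w1 w2.

Definition totally_umbilical (S : set E3) : Prop :=
  forall q, S q -> umbilic S q.

Definition open_part (S P : set E3) : Prop :=
  exists O : set E3, open O /\ S = P `&` O.

End PseudoIsotropicSpace.

(* Main.v *)
From HB Require Import structures.
Require Import Defs.
From mathcomp Require Import all_boot all_order all_algebra.
From mathcomp Require Import all_classical all_reals all_analysis.
From mathcomp Require Import ring lra.
Set Implicit Arguments.
Unset Strict Implicit.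
Unset Printing Implicit Defensive.
Import Order.TTheory GRing.Theory Num.Theory.
Import numFieldNormedType.Exports.
Local Open Scope classical_set_scope.
Local Open Scope ring_scope.

(** Seen from above, an admissible surface is a graph [z = f(x, y)]: admissibility
    says that the projection to the (x, y)-plane has invertible differential in
    every chart, so the inverse function theorem gives local coordinates (x, y)
    ([C1_local_inverse]).  In these coordinates the first two components of the
    Gauss map are [- f_x] and [f_y], the first form is [dx^2 - dy^2] and the
    second form is the Hessian of [f]; hence [II = lambda I] reads
      [f_xx = lambda], [f_xy = 0], [f_yy = - lambda].
    Then [f_x] depends on x only and [f_y] on y only; so [lambda = f_xx] depends
    on x only and [lambda = - f_yy] on y only, which makes [lambda] constant
    ([diagonal_hessian_saddle]).  Integrating twice, [f] is a saddle
    [l/2 (x^2 - y^2) + a x + b y + k] near every point ([umbilical_locally_saddle]).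

    Two saddles with the same germ at a point are equal ([saddle_graph_germ]),
    so by connectedness the coefficients are the same on the whole surface, which
    is then relatively open in a single saddle graph ([connected_germ_family]).
    Saddle graphs are the models: those with [l = 0] are the non-isotropic planes,
    and for [l <> 0] the affine part is removed by a rigid motion, leaving a sphere
    of parabolic type with [p = 1/l] ([saddle_graph_model]).

    Conversely, both models lie in saddle graphs, a rigid motion being
    composed of a translation, a Lorentz boost in (x, y) and a shear in z.  On a
    saddle graph the slopes are affine in x and y, which gives [II = l I] in every
    chart ([saddle_umbilical]). *)

(** * Mean value estimates and critical points *)

Lemma segment_is_derive {R : realType} {V W : normedModType R} (f : V -> W)
    (a v : V) (t : R) :
  differentiable f (a + t *: v) ->
  is_derive t 1 (fun s : R => f (a + s *: v)) ('d f (a + t *: v) v).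
Proof.
move=> df.
have dg : is_diff t (fun s : R => a + s *: v) (fun s => s *: v).
  have -> : (fun s : R => a + s *: v) = cst a + ( *:%R^~ v) by [].
  by rewrite -[X in is_diff _ _ X]add0r; exact: is_diffD.
have dfg : is_diff t (f \o (fun s : R => a + s *: v))
    ('d f (a + t *: v) \o (fun s => s *: v)).
  by apply: is_diff_comp; exact: differentiableP.
split; first exact/derivable1_diffP.
by rewrite deriveE // diff_val /= scale1r.
Qed.

Lemma segment_MVT {R : realType} {V : normedModType R} (f : V -> R) (a b : V) :
  (forall t : R, 0 <= t <= 1 -> differentiable f (a + t *: (b - a))) ->
  exists2 t : R, 0 <= t <= 1 & f b - f a = 'd f (a + t *: (b - a)) (b - a).
Proof.
move=> df.
have [t| |t] := @MVT R (fun t => f (a + t *: (b - a)))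
  (fun t => 'd f (a + t *: (b - a)) (b - a)) 0 1 ltr01.
- rewrite in_itv /= => /andP[t0 t1].
  by apply: segment_is_derive; apply: df; rewrite !ltW.
- apply: derivable_within_continuous => t; rewrite in_itv /= => t01.
  by have [] := segment_is_derive (df _ t01).
- rewrite in_itv /= => /andP[t0 t1].
  rewrite scale0r addr0 scale1r [a + _]addrC subrK subr0 mulr1 => ->.
  by exists t; rewrite ?ltW.
Qed.

Lemma diff_at_min {R : realType} {V : normedModType R} (f : V -> R) (u : V) :
  (\forall w \near u, differentiable f w /\ f u <= f w) ->
  forall v, 'd f u v = 0.
Proof.
move=> fu v; pose g (t : R) := f (u + t *: v).
have [e /= e0 eB] : nbhs_ball (0 : R) [set t | differentiable f (u + t *: v) /\ g 0 <= g t].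
  apply/nbhs_ballP; rewrite /g scale0r addr0.
  have uc : {for (0 : R), continuous (fun t : R => u + t *: v)}.
    by apply: continuousD; [exact: cst_continuous|exact: scalel_continuous].
  have := uc [set w | differentiable f w /\ f u <= f w].
  by rewrite scale0r addr0; exact.
have eB' t : t \in `]-e, e[%R -> differentiable f (u + t *: v) /\ g 0 <= g t.
  rewrite in_itv /= => /andP[te1 te2]; apply: eB.
  by rewrite -ball_normE /= sub0r normrN ltr_norml te1.
have zero : 0 \in `]-e, e[%R by rewrite in_itv /= oppr_lt0 e0.
have ee : -e <= e by lra.
have dg t : t \in `]-e, e[%R -> derivable g t 1.
  by move=> /eB'[/segment_is_derive[]].
have gmin t : t \in `]-e, e[%R -> g 0 <= g t by move=> /eB'[].
have [_ g0] := derive1_at_min ee dg zero gmin.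
have [+ _] := eB' _ zero => /segment_is_derive[_].
by rewrite -/g g0 scale0r addr0.
Qed.

Lemma ball_segment {R : realType} {V : normedModType R} (c a b : V) (r t : R) :
  ball c r a -> ball c r b -> 0 <= t <= 1 -> ball c r (a + t *: (b - a)).
Proof.
rewrite -!ball_normE /= => ca cb /andP[t0 t1].
have -> : c - (a + t *: (b - a)) = (1 - t) *: (c - a) + t *: (c - b).
  rewrite opprD -scalerN scalerBl scale1r -!addrA -scalerN -scalerDr addrA.
  by rewrite !opprB subrKA addrA.
apply: le_lt_trans (ler_normD _ _) _.
rewrite !normrZ ger0_norm ?subr_ge0// ger0_norm//.
have [->|tn0] := eqVneq t 0; first by rewrite subr0 mul1r mul0r addr0.
have tp : 0 < t by rewrite lt_neqAle eq_sym tn0.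
rewrite -[ltRHS]mul1r -{2}(subrK t 1) [ltRHS]mulrDl ler_ltD//.
  by rewrite ler_wpM2l ?subr_ge0// ltW.
by rewrite ltr_pM2l.
Qed.

Lemma diff0_ball_cst {R : realType} {V : normedModType R} (f : V -> R) (c : V) (r : R) :
  (forall u, ball c r u -> differentiable f u /\ forall v, 'd f u v = 0) ->
  forall u, ball c r u -> f u = f c.
Proof.
move=> df u cu; apply/subr0_eq.
have cc : ball c r c.
  by apply: ballxx; move: cu; rewrite -ball_normE; exact/le_lt_trans/normr_ge0.
have [t t01|t t01 ->] := @segment_MVT _ _ f c u.
  by have [] := df _ (ball_segment cc cu t01).
by have [] := df _ (ball_segment cc cu t01).
Qed.

(** * Openness of maps with injective differential *)

Lemma linear_rV_continuous {R : realType} {n : nat} {W : normedModType R}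
  (L : {linear 'rV[R]_n -> W}) : continuous L.
Proof.
have -> : (L : _ -> _) = (fun v : 'rV[R]_n => \sum_(i < n) v 0 i *: L (delta_mx 0 i)).
  apply/funext => v; rewrite {1}[v]row_sum_delta linear_sum.
  by apply: eq_bigr => i _; rewrite linearZ.
move=> v; apply: differentiable_continuous.
have -> : (fun v : 'rV[R]_n => \sum_(i < n) v 0 i *: L (delta_mx 0 i)) =
    \sum_(i < n) (fun v : 'rV[R]_n => v 0 i *: L (delta_mx 0 i)).
  by apply/funext => w; rewrite fct_sumE.
apply: differentiable_sum => i.
by apply: differentiableZl; exact: differentiable_coord.
Qed.

Lemma linear_inj_inverse {R : realType} {n : nat}
    (L : {linear 'rV[R]_n -> 'rV[R]_n}) : injective L ->
  exists G : {linear 'rV[R]_n -> 'rV[R]_n}, cancel L G /\ cancel G L.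
Proof.
move=> Linj; pose M := lin1_mx L.
have LE v : L v = v *m M by rewrite mul_rV_lin1.
have Mu : M \in unitmx.
  rewrite -row_free_unit; apply: inj_row_free => v.
  by rewrite -LE => L0; apply: Linj; rewrite L0 linear0.
exists (mulmxr (invmx M)); split=> v; first by rewrite /= LE mulmxK.
by rewrite LE /= mulmxKV.
Qed.

(** With [approx_is_diff], this trades the Landau form of differentiability for
    an epsilon form, which transports along maps better. *)
Lemma diff_approx {R : realType} {V W : normedModType R} (f : V -> W) (u : V) (e : R) :
  differentiable f u -> 0 < e ->
  \forall w \near u, `|f w - f u - 'd f u (w - u)| <= e * `|w - u|.
Proof.
move=> /diff_locally/eqaddoP df /df.
rewrite [X in _ -> X](near_shift 0); apply: filterS => h.
by rewrite /= !fctE /= subr0 addrK opprD addrA.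
Qed.

Lemma approx_is_diff {R : realType} {V W : normedModType R} (f : V -> W)
    (df : {linear V -> W}) (u : V) : continuous df ->
  (forall e : R, 0 < e ->
     \forall w \near u, `|f w - f u - df (w - u)| <= e * `|w - u|) ->
  is_diff u f df.
Proof.
move=> dfc fdf.
have key : f \o shift u = cst (f u) + df +o_ 0 id.
  apply/eqaddoP => e e0 /=.
  have := fdf _ e0; rewrite [X in X -> _](near_shift 0); apply: filterS => h.
  by rewrite /= !fctE /= subr0 addrK opprD addrA.
have dfE := diff_unique dfc key.
by split => //; apply/diff_locallyP; rewrite dfE.
Qed.

(** The inverse of ['d F u] is Lipschitz, so ['d F u] stretches vectors by a factor
    at least [1/k]; half of it absorbs the error of the linear approximation. *)
Lemma diff_inj_growth {R : realType} {n : nat} (F : 'rV[R]_n -> 'rV[R]_n) (u : 'rV[R]_n) :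
  differentiable F u -> injective ('d F u) ->
  exists2 c : R, 0 < c & \forall w \near u, c * `|w - u| <= `|F w - F u|.
Proof.
move=> dF /linear_inj_inverse[G [GK KG]].
have [k k0 Gk] := linear_lipschitz (@linear_rV_continuous _ _ _ G).
have c0 : 0 < (2 * k)^-1 by rewrite invr_gt0 mulr_gt0.
exists (2 * k)^-1 => //.
apply: filterS (diff_approx dF c0) => w Fw.
have lo : k^-1 * `|w - u| <= `|'d F u (w - u)|.
  by rewrite ler_pdivrMl//; have := Gk ('d F u (w - u)); rewrite GK.
have tri : `|'d F u (w - u)| <= `|F w - F u| + `|F w - F u - 'd F u (w - u)|.
  by rewrite -[X in `|X| <= _](subKr (F w - F u)); exact: ler_normB.
have : k^-1 * `|w - u| = (2 * k)^-1 * `|w - u| + (2 * k)^-1 * `|w - u|.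
  by field; rewrite gt_eqF.
by move=> kE; lra.
Qed.

Lemma le_rV_norm {R : realType} {n : nat} (v : 'rV[R]_n) (i : 'I_n) : `|v 0 i| <= `|v|.
Proof. by rewrite [leRHS]/Num.norm /= mx_normrE; exact: (le_bigmax _ _ (0, i)). Qed.

Lemma rV_norm_attained {R : realType} {n : nat} (v : 'rV[R]_n) :
  v != 0 -> exists i, `|v 0 i| = `|v|.
Proof.
rewrite -normr_eq0 => v0; have [[i j] /= vE] := mx_norm_neq0 v0.
by exists j; rewrite -[RHS]/(mx_norm v) vE (ord1 i).
Qed.

(** The norm of ['rV] is the sup norm; minimisation needs the Euclidean one, whose
    square is differentiable. *)
Definition sqnorm {R : realType} {n : nat} (v : 'rV[R]_n) : R := \sum_(i < n) v 0 i ^+ 2.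

Lemma sqnorm_ge {R : realType} {n : nat} (v : 'rV[R]_n) : `|v| ^+ 2 <= sqnorm v.
Proof.
have [->|/rV_norm_attained[i <-]] := eqVneq v 0.
  by rewrite normr0 expr0n /= sumr_ge0 // => i _; exact: sqr_ge0.
rewrite real_normK ?num_real// /sqnorm (bigD1 i) //= lerDl.
by rewrite sumr_ge0 // => j _; exact: sqr_ge0.
Qed.

Lemma sqnorm_le {R : realType} {n : nat} (v : 'rV[R]_n) : sqnorm v <= n%:R * `|v| ^+ 2.
Proof.
rewrite -[X in X%:R * _]card_ord -sum1_card natr_sum mulr_suml ler_sum// => i _.
rewrite mul1r -[leLHS]real_normK ?num_real//.
by rewrite lerXn2r ?nnegrE//; exact: le_rV_norm.
Qed.

Lemma differentiable_coordf {R : realType} {n : nat} {V : normedModType R}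
    (F : V -> 'rV[R]_n) (u : V) (i : 'I_n) : differentiable F u ->
  differentiable (fun w => F w 0 i) u.
Proof.
move=> dF.
apply: (@differentiable_comp _ _ _ _ F (fun v : 'rV[R]_n => v 0 i)) => //.
exact: differentiable_coord.
Qed.

Lemma diff_coordf {R : realType} {n : nat} {V : normedModType R}
    (F : V -> 'rV[R]_n) (u v : V) (i : 'I_n) : differentiable F u ->
  'd (fun w => F w 0 i) u v = 'd F u v 0 i.
Proof.
move=> dF; rewrite -!deriveE//; last exact: differentiable_coordf.
by rewrite derive_mx ?mxE//; exact: diff_derivable.
Qed.

Lemma is_diff_sqnorm {R : realType} {n : nat} {V : normedModType R}
    (F : V -> 'rV[R]_n) (u : V) : differentiable F u ->
  is_diff u (sqnorm \o F) (fun v => \sum_(i < n) 2 * F u 0 i * ('d F u v) 0 i).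
Proof.
move=> dF.
have sE : sqnorm \o F = \sum_(i < n) (fun w => F w 0 i) ^+ 2.
  by apply/funext => w; rewrite fct_sumE.
have dFi i : differentiable (fun w => F w 0 i) u by exact: differentiable_coordf.
have ds : differentiable (sqnorm \o F) u.
  by rewrite sE; apply: differentiable_sum => i; exact: differentiableX.
split=> //; apply/funext => v; rewrite -deriveE// sE derive_sum; last first.
  by move=> i; apply: derivableX; exact: diff_derivable.
apply: eq_bigr => i _; rewrite deriveX; last exact: diff_derivable.
by rewrite deriveE// diff_coordf.
Qed.

(** The differential of [|G|^2] at [w] is [2 <G w, 'd G w v>]; at a minimum it
    vanishes, and choosing [v] with ['d G w v = G w] leaves [|G w|^2 = 0]. *)
Lemma diff_inj_min_root {R : realType} {n : nat} (G : 'rV[R]_n -> 'rV[R]_n)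
    (w : 'rV[R]_n) :
  (\forall w' \near w, differentiable G w' /\ sqnorm (G w) <= sqnorm (G w')) ->
  injective ('d G w) -> G w = 0.
Proof.
move=> Gmin /linear_inj_inverse[J [_ JK]].
have [dGw _] := nbhs_singleton Gmin.
have [_ dsG] := is_diff_sqnorm dGw.
have : 'd (sqnorm \o G) w (J (G w)) = 0.
  apply: diff_at_min; apply: filterS Gmin => w' [dG ?]; split=> //.
  by have [] := is_diff_sqnorm dG.
rewrite dsG JK => G0.
have : 2 * sqnorm (G w) = 0.
  rewrite -[RHS]G0 mulr_sumr; apply: eq_bigr => i _.
  by rewrite expr2 mulrA.
move=> /eqP; rewrite mulf_eq0 pnatr_eq0 /= => /eqP s0.
have := sqnorm_ge (G w); rewrite s0 => n0.
by apply/eqP; rewrite -normr_eq0 -sqrf_eq0 eq_le sqr_ge0 andbT.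
Qed.

(** For [y] close to [F u], the function [|F w - y|^2] has a minimum on a closed
    ball around [u].  By [diff_inj_growth] the values on the boundary sphere exceed
    the value at [u], so the minimum is interior and [F w = y] there. *)
Lemma diff_inj_nbhs_image {R : realType} {n : nat} (F : 'rV[R]_n -> 'rV[R]_n)
    (u : 'rV[R]_n) (W : set 'rV[R]_n) :
  (\forall w \near u, differentiable F w /\ injective ('d F w)) ->
  nbhs u W -> nbhs (F u) (F @` W).
Proof.
move=> Fu uW.
have [dFu iFu] := nbhs_singleton Fu.
have [c c0 cF] := diff_inj_growth dFu iFu.
have /nbhs_closedballP[r rB] : nbhs u [set w | [/\ W w,
    differentiable F w, injective ('d F w) & c * `|w - u| <= `|F w - F u|]].
  by near=> w; split; [near: w|have [] := near Fu w|have [] := near Fu w|near: w].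
rewrite closed_ballE// in rB.
set B := closed_ball_ _ u r%:num in rB.
have BE w : B w <-> `|u - w| <= r%:num by [].
(* On the sphere of radius [r], [|F w - y| >= c r - d = (n + 1) d] in sup norm,
   while comparing with [u] only allows [|F w - y| <= sqrt n * d]. *)
pose d := c * r%:num / (n%:R + 2).
have n2 : 0 < n%:R + 2 :> R by rewrite ltr_wpDl.
have d0 : 0 < d by rewrite divr_gt0// mulr_gt0.
apply/nbhs_ballP; exists d => //= y; rewrite -ball_normE /= => yd.
have [G GE] : exists G : 'rV[R]_n -> 'rV[R]_n, G = F - cst y by exists (F - cst y).
have dG w : differentiable F w -> is_diff w G ('d F w).
  move=> /differentiableP dF; rewrite GE.
  by rewrite -[X in is_diff _ _ X]subr0; exact: is_diffB.
have [] := @EVT_min_rV R n (sqnorm \o G) B.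
- by exists u; apply/BE; rewrite subrr normr0.
- apply: bounded_closed_compact; last exact: closed_closed_ball_.
  exists (`|u| + r%:num); split; first exact: num_real.
  move=> x xM w /BE uw; apply: le_trans (ltW xM).
  by rewrite -[w in `|w|](subKr u) (le_trans (ler_normB _ _))// lerD2l.
- apply: continuous_in_subspaceT => w; rewrite inE => /rB[_ dF _ _].
  by apply: differentiable_continuous; have [dGw _] := dG _ dF; have [] := is_diff_sqnorm dGw.
move=> w; rewrite inE => Bw wmin.
have [Ww dFw iFw growth] := rB _ Bw.
have wr : `|u - w| < r%:num.
  have uE : `|G u| < d by rewrite GE.
  have wE : c * `|w - u| - d <= `|G w|.
    have : `|F w - F u| <= `|G w| + `|G u|.
      by have -> : F w - F u = G w - G u;
        [rewrite GE [RHS](_ : _ = F w - y - (F u - y))// opprB addrA subrK|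
         exact: ler_normB].
    by move: growth uE; lra.
  have wu : `|G w| ^+ 2 <= n%:R * `|G u| ^+ 2.
    apply: le_trans (sqnorm_ge _) (le_trans _ (sqnorm_le _)).
    by apply: wmin; rewrite inE; apply/BE; rewrite subrr normr0.
  rewrite ltNge; apply/negP => rw.
  have {}wE : (n%:R + 1) * d <= `|G w|.
    apply: le_trans wE.
    have : c * r%:num = (n%:R + 2) * d by rewrite /d; field; rewrite gt_eqF.
    have : c * r%:num <= c * `|w - u| by rewrite ler_pM2l// distrC.
    lra.
  have Gd : `|G u| ^+ 2 <= d ^+ 2 by rewrite lerXn2r ?nnegrE// ltW.
  have nd : ((n%:R + 1) * d) ^+ 2 <= `|G w| ^+ 2.
    by rewrite lerXn2r ?nnegrE// mulr_ge0// ?ltW// ltr_wpDl.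
  have n0 : 0 <= n%:R :> R by [].
  have d2 : 0 < d ^+ 2 by rewrite exprn_gt0.
  have : n%:R * `|G u| ^+ 2 <= n%:R * d ^+ 2 by rewrite ler_wpM2l.
  have : 0 <= n%:R ^+ 2 * d ^+ 2 by rewrite mulr_ge0// sqr_ge0.
  have : 0 <= n%:R * d ^+ 2 by rewrite mulr_ge0// ltW.
  have sqE : ((n%:R + 1) * d) ^+ 2 = n%:R ^+ 2 * d ^+ 2 + 2 * (n%:R * d ^+ 2) + d ^+ 2.
    by ring.
  rewrite sqE in nd; lra.
exists w => //; apply/subr0_eq; have -> : F w - y = G w by rewrite GE.
apply: diff_inj_min_root; last by have [_ ->] := dG _ dFw.
have : \forall w' \near w, ball u r%:num w'.
  by apply: open_nbhs_nbhs; split; [exact: ball_open|rewrite -ball_normE].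
apply: filterS => w'; rewrite -ball_normE /= => /ltW Bw'.
have [_ /dG[dGw' _] _ _] := rB _ Bw'.
by split; [exact: dGw'|apply: wmin; rewrite inE].
Unshelve. all: by end_near.
Qed.

(** * The local inverse theorem *)

Definition diff_continuous_at {R : realType} {V W : normedModType R} (F : V -> W) (u : V) :=
  forall e : R, 0 < e ->
    \forall w \near u, forall v, `|'d F w v - 'd F u v| <= e * `|v|.

(** If [F a = F b] with [b - a = v], the mean value theorem on the coordinate in
    which ['d F u v] attains its sup norm gives a nearby differential that kills
    that coordinate of [v], against continuity of the differential. *)
Lemma C1_locally_injective {R : realType} {n : nat} (F : 'rV[R]_n -> 'rV[R]_n)
    (u : 'rV[R]_n) :
  (\forall w \near u, differentiable F w) -> injective ('d F u) ->
  diff_continuous_at F u ->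
  exists2 r : R, 0 < r & {in (ball u r : set 'rV[R]_n) &, injective F}.
Proof.
move=> dF /linear_inj_inverse[G [GK _]] cF.
have [k k0 Gk] := linear_lipschitz (@linear_rV_continuous _ _ _ G).
have e0 : 0 < (2 * k)^-1 by rewrite invr_gt0 mulr_gt0.
have /nbhs_ballP[r /= r0 rB] : nbhs u [set w | differentiable F w /\
    forall v, `|'d F w v - 'd F u v| <= (2 * k)^-1 * `|v|].
  by near=> w; split; [near: w|near: w; exact: cF].
exists r => // a b /[!inE] ua ub Fab; apply/eqP; apply: contraT => ab.
pose v := b - a.
have v0 : 0 < `|v| by rewrite normr_gt0 subr_eq0 eq_sym.
have lo : k^-1 * `|v| <= `|'d F u v|.
  by rewrite ler_pdivrMl//; have := Gk ('d F u v); rewrite GK.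
have [i vi] : exists i, `|'d F u v 0 i| = `|'d F u v|.
  by apply: rV_norm_attained; rewrite -normr_gt0 (lt_le_trans _ lo)// mulr_gt0 ?invr_gt0.
have segB t : 0 <= t <= 1 -> ball u r (a + t *: (b - a)) by exact: ball_segment.
have [t /segB/rB[dFt _]|t /segB/rB[dFt cFt]] := @segment_MVT _ _ (fun w => F w 0 i) a b.
  exact: differentiable_coordf.
rewrite /= Fab subrr diff_coordf// -/v => /esym Ft0.
have norm_ge (x y : 'rV[R]_n) : x 0 i = 0 -> `|y 0 i| <= `|x - y|.
  by move=> x0; have := le_rV_norm (x - y) i; rewrite !mxE x0 sub0r normrN.
have := le_trans (norm_ge _ _ Ft0) (cFt v); rewrite vi.
move=> /(le_trans lo); rewrite ler_pM2r// lef_pV2 ?posrE ?mulr_gt0//.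
lra.
Unshelve. all: by end_near. Qed.

(** The inverse of the restriction of [F] to a small ball.  Its differentiability at
    [F a] follows from [G (F b - F a) - (b - a) = o(|b - a|)], where [G] inverts
    ['d F a], and [|b - a| = O(|F b - F a|)]; openness makes it valid for all points
    near [F a]. *)
Lemma C1_local_inverse {R : realType} {n : nat} (F : 'rV[R]_n -> 'rV[R]_n)
    (u : 'rV[R]_n) (W : set 'rV[R]_n) :
  (\forall w \near u, differentiable F w /\ injective ('d F w)) ->
  diff_continuous_at F u -> nbhs u W ->
  exists psi : 'rV[R]_n -> 'rV[R]_n,
    (\forall w \near u, psi (F w) = w) /\
    \forall y \near F u, [/\ W (psi y), F (psi y) = y & differentiable psi y].
Proof.
move=> Fu cF uW.
have dF : \forall w \near u, differentiable F w by apply: filterS Fu => w [].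
have [_ iF] := nbhs_singleton Fu.
have [r r0 Finj] := C1_locally_injective dF iF cF.
have /nbhs_ballP[s /= s0 sB] : nbhs u [set w | [/\ W w, ball u r w,
    differentiable F w & injective ('d F w)]].
  near=> w; split; [near: w|near: w|near: w|].
  - by [].
  - exact: nbhsx_ballx.
  - by [].
  - by have [] := near Fu w.
pose U := ball u s.
have Uinj a b : U a -> U b -> F a = F b -> a = b.
  by move=> /sB[_ ra _ _] /sB[_ rb _ _]; apply: Finj; rewrite inE.
have nearU a : U a -> \forall w \near a, U w.
  by move=> Ua; apply: open_nbhs_nbhs; split=> //; exact: ball_open.
have Fopen a A : U a -> nbhs a A -> nbhs (F a) (F @` (A `&` U)).
  move=> Ua aA; apply: diff_inj_nbhs_image; last first.
    by apply: filterI => //; exact: nearU.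
  by apply: filterS (nearU _ Ua) => w /sB[].
pose psi y := get [set a | U a /\ F a = y].
have psiK a : U a -> psi (F a) = a.
  move=> Ua; have [] : [set b | U b /\ F b = F a] (psi (F a)) by apply: getPex; exists a.
  by move=> Ub; exact: Uinj.
exists psi; split; first by apply: filterS (nearU _ (ballxx _ s0)) => w; exact: psiK.
have UT : nbhs u setT by exact: filterT.
have UF : nbhs (F u) (F @` U) by have := Fopen u setT (ballxx _ s0) UT; rewrite setTI.
apply: (filterS _ UF) => _ [a Ua <-].
rewrite psiK//; have [Wa _ dFa iFa] := sB _ Ua; split=> //.
have [G [GK KG]] := linear_inj_inverse iFa.
have Gc : continuous G by exact: linear_rV_continuous.
have [k k0 Gk] := linear_lipschitz Gc.
have [c c0 cFa] := diff_inj_growth dFa iFa.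
suff [] : is_diff (F a) psi G by [].
apply: (approx_is_diff Gc) => e e0.
have e'0 : 0 < e * c / k by rewrite divr_gt0// mulr_gt0.
apply: (filterS _ (Fopen a _ Ua (filterI cFa (diff_approx dFa e'0)))) => _
  [b [[/= gb ab] Ub] <-]; rewrite !psiK//.
rewrite -[X in `|X - _|]GK -linearB -normrN -linearN opprB.
apply: le_trans (Gk _) _; apply: (@le_trans _ _ (e * (c * `|b - a|))); last by rewrite ler_pM2l.
by rewrite -ler_pdivlMl//; apply: le_trans ab _; rewrite mulrA le_eqVlt; apply/orP; left;
  apply/eqP; ring.
Unshelve. all: by end_near. Qed.

(** * Functions with Hessian lambda diag(1, -1) *)

Definition saddle {R : realType} (l a b c : R) (y : 'rV[R]_2) : R :=
  l / 2 * (y 0 0 ^+ 2 - y 0 1 ^+ 2) + a * y 0 0 + b * y 0 1 + c.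

Lemma is_diff_coord {R : realType} {n : nat} (y : 'rV[R]_n) (i : 'I_n) :
  is_diff y (fun v : 'rV[R]_n => v 0 i) (fun v => v 0 i).
Proof.
split; first exact: differentiable_coord.
apply/funext => v; have := @diff_coordf _ _ _ id y v i.
rewrite (diff_val (is_diff_def := is_diff_id y)); apply.
exact: ex_diff.
Qed.

Lemma is_diff_saddle {R : realType} (l a b c : R) (y : 'rV[R]_2) :
  is_diff y (saddle l a b c)
    (fun v => (l * y 0 0 + a) * v 0 0 + (b - l * y 0 1) * v 0 1).
Proof.
have d0 := is_diff_coord y 0; have d1 := is_diff_coord y 1.
have -> : saddle l a b c = (l / 2) \*: ((fun v : 'rV[R]_2 => v 0 0) ^+ 2 -
    (fun v : 'rV[R]_2 => v 0 1) ^+ 2) + a \*: (fun v : 'rV[R]_2 => v 0 0)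
    + b \*: (fun v : 'rV[R]_2 => v 0 1) + cst c.
  by apply/funext => v.
apply: is_diff_eq; apply/funext => v; rewrite /= !fctE /GRing.scale /=.
by rewrite [X in _ + X](_ : _ = 0)//; field.
Qed.

Section DiagonalHessian.
Context {R : realType}.
Variables (f p q lam : 'rV[R]_2 -> R) (c : 'rV[R]_2) (r : R).
Local Notation B := (ball c r).
Hypothesis df : forall y, B y -> is_diff y f (fun v => p y * v 0 0 + q y * v 0 1).
Hypothesis dp : forall y, B y -> is_diff y p (fun v => lam y * v 0 0).
Hypothesis dq : forall y, B y -> is_diff y q (fun v => - lam y * v 0 1).

(** A derivative along [e] only depends on the values on a line of direction [e], so
    it can be compared along parallel lines. *)
Let line_diff_eq (h : 'rV[R]_2 -> R) (e y y' : 'rV[R]_2) : B y -> B y' ->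
  differentiable h y -> differentiable h y' ->
  (forall t, B (y + t *: e) -> B (y' + t *: e) -> h (y + t *: e) = h (y' + t *: e)) ->
  'd h y e = 'd h y' e.
Proof.
move=> By By' dy dy' hh.
have lc z : {for (0 : R), continuous (fun t : R => z + t *: e)}.
  by apply: continuousD; [exact: cst_continuous|exact: scalel_continuous].
have nB z : B z -> \forall t \near (0 : R), B (z + t *: e).
  move=> Bz; have := lc z B; rewrite scale0r addr0; apply.
  by apply: open_nbhs_nbhs; split=> //; exact: ball_open.
have d z : differentiable h z -> 'D_1 (fun t : R => h (z + t *: e)) 0 = 'd h z e.
  move=> dz; have := @segment_is_derive _ _ _ h z e 0.
  by rewrite scale0r addr0 => /(_ dz)[].
apply: (etrans (esym (d _ dy))); apply: (etrans _ (d _ dy')).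
apply: near_eq_derive.
by apply: filterS2 (nB _ By) (nB _ By') => t; exact: hh.
Qed.

(** The balls of ['rV] are squares, so they contain with [y] and [y'] the point with
    the x-coordinate of [y] and the y-coordinate of [y']. *)
Let corner (y y' : 'rV[R]_2) : 'rV[R]_2 := \row_j (if j == 0 then y 0 0 else y' 0 1).

Let cornerB y y' : B y -> B y' -> B (corner y y').
Proof.
rewrite -!ball_normE /= => By By'.
have [->|/rV_norm_attained[i <-]] := eqVneq (c - corner y y') 0.
  by rewrite normr0 (le_lt_trans _ By).
rewrite !mxE; have [->|i0] := eqVneq i 0.
  by apply: le_lt_trans By; have := le_rV_norm (c - y) 0; rewrite !mxE.
have -> : i = 1 by apply/val_inj; case: i i0 => [[|[|]]].
by apply: le_lt_trans By'; have := le_rV_norm (c - y') 1; rewrite !mxE.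
Qed.

Let p_eq y y' : B y -> B y' -> y 0 0 = y' 0 0 -> p y = p y'.
Proof.
move=> By By' yy; apply/esym/subr0_eq.
have segB t : 0 <= t <= 1 -> B (y + t *: (y' - y)) by exact: ball_segment.
have [t /segB/dp[]//|t /segB/dp[_ dpt] ->] := @segment_MVT _ _ p y y'.
by rewrite dpt !mxE yy subrr mulr0.
Qed.

Let q_eq y y' : B y -> B y' -> y 0 1 = y' 0 1 -> q y = q y'.
Proof.
move=> By By' yy; apply/esym/subr0_eq.
have segB t : 0 <= t <= 1 -> B (y + t *: (y' - y)) by exact: ball_segment.
have [t /segB/dq[]//|t /segB/dq[_ dpt] ->] := @segment_MVT _ _ q y y'.
by rewrite dpt !mxE yy subrr mulr0.
Qed.

(** As [p] is a function of x alone, [lam = p_x] keeps its value from [y] to the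
    corner, where x is the same; as [q] is a function of y alone, [lam = - q_y]
    keeps its value from the corner to [y']. *)
Let lam_eq y y' : B y -> B y' -> lam y = lam y'.
Proof.
move=> By By'; have Bm := cornerB By By'.
have dpe z : B z -> 'd p z (delta_mx 0 0) = lam z.
  by move=> /dp[_ ->]; rewrite mxE !eqxx mulr1.
have dqe z : B z -> 'd q z (delta_mx 0 1) = - lam z.
  by move=> /dq[_ ->]; rewrite mxE !eqxx mulr1.
transitivity (lam (corner y y')).
  apply: etrans (esym (dpe _ By)) (etrans _ (dpe _ Bm)).
  apply: line_diff_eq => //; [by have [] := dp By|by have [] := dp Bm|].
  by move=> t Bt Bt'; apply: p_eq => //; rewrite !mxE.
apply: oppr_inj; apply: etrans (esym (dqe _ Bm)) (etrans _ (dqe _ By')).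
apply: line_diff_eq => //; [by have [] := dq Bm|by have [] := dq By'|].
by move=> t Bt Bt'; apply: q_eq => //; rewrite !mxE.
Qed.

(** With [lam] constant, [p - l x], [q + l y] and [f] minus a saddle have zero
    differential in turn. *)
Lemma diagonal_hessian_saddle : exists l a b k,
  forall y, B y -> f y = saddle l a b k y.
Proof.
pose l := lam c.
have [r0|r0] := ltP 0 r; last first.
  exists 0, 0, 0, 0 => y; rewrite -ball_normE /= => yr.
  by have := le_lt_trans (normr_ge0 _) (lt_le_trans yr r0); rewrite ltxx.
have Bc : B c by exact: ballxx.
have pE y : B y -> p y = l * y 0 0 + (p c - l * c 0 0).
  move=> By; have := @diff0_ball_cst _ _ (p - saddle 0 l 0 0) c r _ y By.
  rewrite /saddle /= !fctE => H.
  suff : p y - l * y 0 0 = p c - l * c 0 0 by move=> <-; rewrite addrC subrK.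
  have : p y - saddle 0 l 0 0 y = p c - saddle 0 l 0 0 c.
    apply: H => z Bz; have dpz := dp Bz; have dsz := is_diff_saddle 0 l 0 0 z.
    have [dz dzE] := is_diffB dpz dsz; split=> // v.
    by rewrite dzE /= !fctE /= (lam_eq Bz Bc) -/l; ring.
  by rewrite /saddle => E; lra.
have qE y : B y -> q y = q c + l * c 0 1 - l * y 0 1.
  move=> By; have H := @diff0_ball_cst _ _ (q - saddle 0 0 (-l) 0) c r _ y By.
  have : q y - saddle 0 0 (-l) 0 y = q c - saddle 0 0 (-l) 0 c.
    apply: H => z Bz; have dpz := dq Bz; have dsz := is_diff_saddle 0 0 (-l) 0 z.
    have [dz dzE] := is_diffB dpz dsz; split=> // v.
    by rewrite dzE /= !fctE /= (lam_eq Bz Bc) -/l; ring.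
  by rewrite /saddle => E; lra.
pose s := saddle l (p c - l * c 0 0) (q c + l * c 0 1) 0.
exists l, (p c - l * c 0 0), (q c + l * c 0 1), (f c - s c) => y By.
have H := @diff0_ball_cst _ _ (f - s) c r _ y By.
have : f y - s y = f c - s c.
  apply: H => z Bz; have dpz := df Bz.
  have dsz := is_diff_saddle l (p c - l * c 0 0) (q c + l * c 0 1) 0 z.
  have [dz dzE] := is_diffB dpz dsz; split=> // v.
  by rewrite dzE /= !fctE /= (pE _ Bz) (qE _ Bz); ring.
by rewrite {1}/s /saddle => E; lra.
Qed.
End DiagonalHessian.

(** * The vertical projection in a chart *)

Section Projection.
Context {R : realType}.

Definition hproj (q : 'rV[R]_3) : 'rV[R]_2 := lsubmx (q : 'rV[R]_(2 + 1)).

Lemma hproj_linear : linear hproj.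
Proof. by move=> k a b; rewrite /hproj linearP. Qed.
HB.instance Definition _ := GRing.isLinear.Build R 'rV[R]_3 'rV[R]_2 _ hproj hproj_linear.

Lemma hproj0 (q : 'rV[R]_3) : hproj q 0 0 = q 0 0.
Proof. by rewrite mxE; congr (q 0 _); exact: val_inj. Qed.

Lemma hproj1 (q : 'rV[R]_3) : hproj q 0 1 = q 0 1.
Proof. by rewrite mxE; congr (q 0 _); exact: val_inj. Qed.

Lemma row2P (v w : 'rV[R]_2) : v 0 0 = w 0 0 -> v 0 1 = w 0 1 -> v = w.
Proof.
move=> h0 h1; apply/rowP => i; have [->//|i0] := eqVneq i 0.
by have -> : i = 1 by apply/val_inj; case: i i0 => [[|[|]]].
Qed.

Lemma row3P (v w : 'rV[R]_3) : hproj v = hproj w -> v 0 2 = w 0 2 -> v = w.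
Proof.
move=> h h2; apply/rowP => i.
have [->|i0] := eqVneq i 0; first by rewrite -!hproj0 h.
have [->|i1] := eqVneq i 1; first by rewrite -!hproj1 h.
by have -> : i = 2 by apply/val_inj; case: i i0 i1 => [[|[|[|]]]].
Qed.

Lemma hproj_continuous : continuous hproj.
Proof. exact: linear_rV_continuous. Qed.

Lemma is_diff_hproj {V : normedModType R} (x : V -> 'rV[R]_3) (u : V) :
  differentiable x u -> is_diff u (hproj \o x) (fun v => hproj ('d x u v)).
Proof.
move=> dx.
have dh : differentiable hproj (x u) by exact/linear_differentiable/hproj_continuous.
split; first exact: differentiable_comp.
by rewrite diff_comp// diff_lin//; exact: hproj_continuous.
Qed.

Lemma diff_row2 {W : normedModType R} (x : 'rV[R]_2 -> W) (u v : 'rV[R]_2) :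
  differentiable x u ->
  'd x u v = v 0 0 *: 'D_(delta_mx 0 0) x u + v 0 1 *: 'D_(delta_mx 0 1) x u.
Proof.
move=> dx; rewrite !deriveE// -!linearZ -linearD; congr ('d x u _).
by apply: row2P; rewrite !mxE /= ?(mulr1, mulr0, addr0, add0r).
Qed.

End Projection.

Section Chart.
Context {R : realType}.
Variables (x : 'rV[R]_2 -> 'rV[R]_3).

(** The first two components of the Gauss map.  In terms of the graph function they
    are [- f_x] and [f_y], see [diff_height]. *)
Definition gauss1 (u : 'rV[R]_2) : R := minor x 1 2 u / minor x 0 1 u.
Definition gauss2 (u : 'rV[R]_2) : R := minor x 0 2 u / minor x 0 1 u.

(** A tangent vector with zero projection is vertical, and would make the tangent
    plane isotropic. *)
Lemma hproj_diff_injective (u : 'rV[R]_2) : differentiable x u ->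
  injective ('d x u) -> ~ isotropic (tangent_plane x u) ->
  forall v, hproj ('d x u v) = 0 -> v = 0.
Proof.
move=> dx ix niso v hv.
have [s0|s0] := eqVneq ('d x u v 0 2) 0.
  by apply: ix; rewrite linear0; apply: row3P; rewrite ?linear0 ?mxE.
case: niso; exists (x u) => t.
exists (t *: vec3 0 0 1) => //; exists ((t / 'd x u v 0 2) *: v) => //.
rewrite linearZ /=; apply: row3P; last by rewrite !mxE /= mulr1 divfK.
rewrite linearZ /= hv scaler0 linearZ /=.
by apply: row2P; rewrite !mxE /= ?hproj0 ?hproj1 ?mxE /= mulr0.
Qed.

(** If the Jacobian [X_12] vanished, the vectors [(x_2^1, - x_1^1)] and
    [(x_2^2, - x_1^2)] would be in the kernel of the projected differential. *)
Lemma minor01_neq0 (u : 'rV[R]_2) : differentiable x u ->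
  (forall v, hproj ('d x u v) = 0 -> v = 0) -> minor x 0 1 u != 0.
Proof.
move=> dx ker0; apply/eqP; rewrite /minor.
set x1 := 'D_(delta_mx 0 0) x u; set x2 := 'D_(delta_mx 0 1) x u => m0.
have dxE v : 'd x u v = v 0 0 *: x1 + v 0 1 *: x2 by exact: diff_row2.
clearbody x1 x2.
have k (a b : R) : a * x1 0 0 + b * x2 0 0 = 0 -> a * x1 0 1 + b * x2 0 1 = 0 ->
    a = 0 /\ b = 0.
  move=> e0 e1; pose v : 'rV[R]_2 := \row_j (if j == 0 then a else b).
  have v0 : v = 0.
    apply: ker0; rewrite dxE; apply: row2P; rewrite ?hproj0 ?hproj1 !mxE /= ?mxE//.
  by split; [have := congr1 (fun w : 'rV[R]_2 => w 0 0) v0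
    |have := congr1 (fun w : 'rV[R]_2 => w 0 1) v0]; rewrite !mxE.
have [x20 x10] : x2 0 0 = 0 /\ - x1 0 0 = 0.
  by apply: k; lra.
have [x21 x11] : x2 0 1 = 0 /\ - x1 0 1 = 0.
  by apply: k; lra.
have [] : (1 : R) = 0 /\ (0 : R) = 0.
  by apply: k; lra.
by move/eqP; rewrite oner_eq0.
Qed.

(** This is [dz = f_x dx + f_y dy], by Cramer's rule. *)
Lemma diff_height (u v : 'rV[R]_2) : differentiable x u -> minor x 0 1 u != 0 ->
  'd x u v 0 2 = - gauss1 u * 'd x u v 0 0 + gauss2 u * 'd x u v 0 1.
Proof.
move=> dx; rewrite (diff_row2 v dx) /gauss1 /gauss2 /minor.
set x1 := 'D_(delta_mx 0 0) x u; set x2 := 'D_(delta_mx 0 1) x u.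
clearbody x1 x2 => m0; rewrite !mxE.
by field.
Qed.

End Chart.

(** * Gauss map and second fundamental form *)

Section GaussMap.
Context {R : realType}.

Lemma vec3_0 (a b c : R) : vec3 a b c 0 0 = a. Proof. by rewrite mxE. Qed.
Lemma vec3_1 (a b c : R) : vec3 a b c 0 1 = b. Proof. by rewrite mxE. Qed.
Lemma vec3_2 (a b c : R) : vec3 a b c 0 2 = c. Proof. by rewrite mxE. Qed.

Variables (x : 'rV[R]_2 -> 'rV[R]_3).

Lemma differentiable_minor (i j : 'I_3) (u : 'rV[R]_2) :
  differentiable ('D_(delta_mx 0 0) x) u -> differentiable ('D_(delta_mx 0 1) x) u ->
  differentiable (minor x i j) u.
Proof.
move=> d1 d2; pose D e k w := 'D_e x w 0 k : R.
have -> : minor x i j = D (delta_mx 0 0) i * D (delta_mx 0 1) j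
    - D (delta_mx 0 0) j * D (delta_mx 0 1) i by [].
have D1 k : differentiable (D (delta_mx 0 0) k) u := differentiable_coordf k d1.
have D2 k : differentiable (D (delta_mx 0 1) k) u := differentiable_coordf k d2.
exact: differentiableB (differentiableM (D1 i) (D2 j)) (differentiableM (D1 j) (D2 i)).
Qed.

Lemma differentiable_gauss (u : 'rV[R]_2) :
  differentiable ('D_(delta_mx 0 0) x) u -> differentiable ('D_(delta_mx 0 1) x) u ->
  minor x 0 1 u != 0 ->
  differentiable (gauss1 x) u /\ differentiable (gauss2 x) u.
Proof.
move=> d1 d2 m0.
have dm i j : differentiable (minor x i j) u by exact: differentiable_minor.
have dV := differentiableV (dm 0 1) m0.
split.
- have -> : gauss1 x = minor x 1 2 * (fun w => (minor x 0 1 w)^-1) by [].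
  exact: differentiableM.
- have -> : gauss2 x = minor x 0 2 * (fun w => (minor x 0 1 w)^-1) by [].
  exact: differentiableM.
Qed.

Lemma derive_gauss_map (u v : 'rV[R]_2) :
  differentiable (gauss1 x) u -> differentiable (gauss2 x) u ->
  'D_v (gauss_map x) u 0 0 = 'd (gauss1 x) u v /\
  'D_v (gauss_map x) u 0 1 = 'd (gauss2 x) u v.
Proof.
move=> d1 d2.
have E0 : (fun w => gauss_map x w 0 0) = gauss1 x.
  by apply/funext => w; exact: vec3_0.
have E1 : (fun w => gauss_map x w 0 1) = gauss2 x.
  by apply/funext => w; exact: vec3_1.
have E2 : (fun w => gauss_map x w 0 2) =
    cst (1 / 2) * (cst 1 - (gauss1 x ^+ 2 - gauss2 x ^+ 2)).
  by apply/funext => w; exact: vec3_2.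
have d3 : differentiable (fun w => gauss_map x w 0 2) u.
  rewrite E2; apply: differentiableM; first exact: differentiable_cst.
  apply: differentiableB; first exact: differentiable_cst.
  by apply: differentiableB; exact: differentiableX.
have dg : derivable (gauss_map x) u v.
  apply/derivable_mxP => i j; rewrite (ord1 i); apply: diff_derivable.
  have [->|i0] := eqVneq j 0; first by rewrite E0.
  have [->|i1] := eqVneq j 1; first by rewrite E1.
  by have -> : j = 2 by apply/val_inj; case: j i0 i1 => [[|[|[|]]]].
rewrite derive_mx//; split; rewrite mxE.
  by rewrite E0; exact: deriveE.
by rewrite E1; exact: deriveE.
Qed.

(** The preimage of a tangent vector chosen in the shape operator is determined, as
    ['d x u] is injective. *)
Lemma second_formE (u v : 'rV[R]_2) (w : 'rV[R]_3) :
  injective ('d x u) ->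
  differentiable (gauss1 x) u -> differentiable (gauss2 x) u ->
  second_form x u ('d x u v) w =
    'd (gauss2 x) u v * w 0 1 - 'd (gauss1 x) u v * w 0 0.
Proof.
move=> ix d1 d2; rewrite /second_form /shape_operator /surface_derive.
have -> : get [set v0 | 'd x u v0 = 'd x u v] = v.
  by apply: ix; apply: (@getPex _ [set v0 | 'd x u v0 = 'd x u v]); exists v.
have [E1 E2] := derive_gauss_map v d1 d2.
apply: etrans _ (congr2 (fun a b => b * w 0 1 - a * w 0 0) E1 E2).
have pz_opp (D : 'rV[R]_3) : pz_inner (- D) w = D 0 1 * w 0 1 - D 0 0 * w 0 0.
  by rewrite /pz_inner !mxE; ring.
exact: pz_opp.
Qed.

End GaussMap.

(** * Umbilic points in a chart *)

Lemma near_eq_diff {R : realType} {V W : normedModType R} (f g : V -> W) (u v : V) :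
  (\forall w \near u, f w = g w) -> differentiable f u -> differentiable g u ->
  'd f u v = 'd g u v.
Proof.
move=> fg df dg; apply: etrans (esym (deriveE v df)) (etrans _ (deriveE v dg)).
exact: near_eq_derive.
Qed.

Section Umbilics.
Context {R : realType}.
Variables (x : 'rV[R]_2 -> 'rV[R]_3).

(** What a chart of an admissible surface provides at each of its points. *)
Definition admissible_at (u : 'rV[R]_2) : Prop :=
  [/\ differentiable x u, forall i, differentiable ('D_(delta_mx 0 i) x) u,
      injective ('d x u) & ~ isotropic (tangent_plane x u)].

Lemma admissible_chart (S : set 'rV[R]_3) (V : set 'rV[R]_2) :
  admissible_surface S -> local_parameterization S V x ->
  forall u, V u -> admissible_at u.
Proof.
move=> [_ Sadm] xloc u Vu; have [_ xs xi _ _] := xloc.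
split; [exact: (xs [::])|by move=> i; exact: (xs [:: i])|exact: xi|].
exact: Sadm xloc _ Vu.
Qed.

Variable u : 'rV[R]_2.
Hypothesis xu : admissible_at u.

Let dx : differentiable x u. Proof. by case: xu. Qed.
Let ix : injective ('d x u). Proof. by case: xu. Qed.

Lemma admissible_ker v : hproj ('d x u v) = 0 -> v = 0.
Proof. by apply: hproj_diff_injective; case: xu. Qed.

Lemma admissible_proj_injective : injective ('d (hproj \o x) u).
Proof.
have [_ dE] := is_diff_hproj dx.
move=> a b; rewrite dE => ab; apply/subr0_eq/admissible_ker.
by rewrite !linearB /= ab subrr.
Qed.

Lemma admissible_minor : minor x 0 1 u != 0.
Proof. by apply: minor01_neq0 => // v; exact: admissible_ker. Qed.

Lemma admissible_gauss : differentiable (gauss1 x) u /\ differentiable (gauss2 x) u.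
Proof.
by have [_ d _ _] := xu; apply: differentiable_gauss => //; exact: admissible_minor.
Qed.

Lemma admissible_proj_surj (y : 'rV[R]_2) : exists v, hproj ('d x u v) = y.
Proof.
have iL : injective (hproj \o 'd x u).
  by move=> a b /= ab; apply/subr0_eq/admissible_ker; rewrite !linearB /= ab subrr.
have [G [_ KG]] := linear_inj_inverse iL.
by exists (G y); exact: KG.
Qed.

(** Tangent vectors project onto all of the plane, so [II = lam I] can be tested on
    [w2] above the two unit vectors. *)
Lemma proportional_formsP (lam : R) :
  (forall w1 w2 : 'rV[R]_3, tangent_space x u w1 -> tangent_space x u w2 ->
     second_form x u w1 w2 = lam * pz_inner w1 w2) <->
  (forall v, 'd (gauss1 x) u v = - lam * 'd x u v 0 0 /\
             'd (gauss2 x) u v = - lam * 'd x u v 0 1).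
Proof.
have [d1 d2] := admissible_gauss.
split=> [H v|H _ _ [v _ <-] [w _ <-]]; last first.
  have [g1 g2] := H v.
  apply: etrans (second_formE _ _ ix d1 d2) _.
  apply: etrans (congr2 (fun a b => b * _ - a * _) g1 g2) _.
  have pz (a b : 'rV[R]_3) :
      - lam * a 0 1 * b 0 1 - - lam * a 0 0 * b 0 0 = lam * pz_inner a b.
    by rewrite /pz_inner; ring.
  exact: pz.
have key s t : 'd (gauss2 x) u v * t - 'd (gauss1 x) u v * s
    = lam * ('d x u v 0 0 * s - 'd x u v 0 1 * t).
  have [v' v'E] := admissible_proj_surj (\row_j (if j == 0 then s else t)).
  have -> : s = 'd x u v' 0 0 by rewrite -hproj0 v'E mxE.
  have -> : t = 'd x u v' 0 1 by rewrite -hproj1 v'E mxE.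
  apply: etrans (esym (second_formE _ _ ix d1 d2)) _.
  by apply: H; [exists v|exists v'].
have solve (g1 g2 a0 a1 : R) : g2 * 0 - g1 * 1 = lam * (a0 * 1 - a1 * 0) ->
    g2 * 1 - g1 * 0 = lam * (a0 * 0 - a1 * 1) -> g1 = - lam * a0 /\ g2 = - lam * a1.
  by move=> ? ?; split; lra.
exact: solve (key 1 0) (key 0 1).
Qed.

End Umbilics.

Lemma umbilic_gauss {R : realType} (S : set 'rV[R]_3) (V : set 'rV[R]_2)
    (x : 'rV[R]_2 -> 'rV[R]_3) (u : 'rV[R]_2) :
  local_parameterization S V x -> V u -> admissible_at x u -> umbilic S (x u) ->
  exists lam, forall v, 'd (gauss1 x) u v = - lam * 'd x u v 0 0 /\
             'd (gauss2 x) u v = - lam * 'd x u v 0 1.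
Proof.
move=> xl Vu xu /(_ V x u xl Vu erefl)[lam H].
by exists lam; apply/proportional_formsP.
Qed.

Definition saddle_graph {R : realType} (l a b k : R) : set 'rV[R]_3 :=
  [set q : 'rV[R]_3 | q 0 2 = saddle l a b k (hproj q)].

(** In a chart, comparing [diff_height] with the differential of the equation of the
    saddle gives [f_x = l x + a] and [f_y = b - l y]; differentiating once more
    yields the forms of [proportional_formsP] with [lam = l]. *)
Lemma saddle_umbilical {R : realType} (S : set 'rV[R]_3) (l a b k : R) :
  admissible_surface S -> S `<=` saddle_graph l a b k -> totally_umbilical S.
Proof.
move=> Sadm SG q Sq V x u xl Vu xuq; exists l.
have adm w : V w -> admissible_at x w by exact: (admissible_chart Sadm xl).
apply/(proportional_formsP (adm _ Vu)).
have [Vo _ _ _ xO] := xl.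
have VS w : V w -> S (x w).
  move=> Vw; have [N [_ VN]] := xO V Vo (fun _ h => h).
  have: (S `&` N) (x w) by rewrite -VN; exists w.
  by case.
have nV w : V w -> nbhs w V by move=> Vw; exact: open_nbhs_nbhs.
have height w v : V w -> 'd x w v 0 2 =
    (l * x w 0 0 + a) * 'd x w v 0 0 + (b - l * x w 0 1) * 'd x w v 0 1.
  move=> Vw; have [dxw _ _ _] := adm _ Vw.
  have dh := is_diff_hproj dxw.
  have ds := is_diff_saddle l a b k (hproj (x w)).
  have [dc dcE] := is_diff_comp dh ds.
  rewrite -diff_coordf//.
  have -> : 'd (fun w => x w 0 2) w v = 'd (saddle l a b k \o (hproj \o x)) w v.
    apply: near_eq_diff => //; last exact: differentiable_coordf.
    by apply: filterS (nV _ Vw) => z /VS/SG.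
  by rewrite dcE /= !hproj0 !hproj1.
have slopes w : V w -> gauss1 x w = - (l * x w 0 0 + a) /\ gauss2 x w = b - l * x w 0 1.
  move=> Vw; have xw := adm _ Vw; have [dxw _ _ _] := xw.
  have m0 := admissible_minor xw.
  have H (y : 'rV[R]_2) : (- gauss1 x w) * y 0 0 + gauss2 x w * y 0 1 =
      (l * x w 0 0 + a) * y 0 0 + (b - l * x w 0 1) * y 0 1.
    have [v <-] := admissible_proj_surj xw y.
    by rewrite !hproj0 !hproj1 -diff_height// height.
  have := H (delta_mx 0 0); have := H (delta_mx 0 1).
  by rewrite !mxE /=; split; lra.
move=> v; have [d1 d2] := admissible_gauss (adm _ Vu).
have [dxu _ _ _] := adm _ Vu.
have lin (c0 c1 : R) i : is_diff u (cst c0 + c1 \*: (fun w => x w 0 i))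
    (c1 \*: (fun w => 'd x u w 0 i)).
  have di := differentiable_coordf i dxu.
  have -> : (fun w => 'd x u w 0 i) = 'd (fun w => x w 0 i) u.
    by apply/funext => w; rewrite diff_coordf.
  rewrite -[X in is_diff _ _ X]add0r; apply: is_diffD.
  by apply: is_diffZ; exact: differentiableP.
split.
- have [dl dlE] := lin (- a) (- l) 0.
  apply: (etrans (near_eq_diff v _ d1 dl)); last by rewrite dlE.
  apply: filterS (nV _ Vu) => w /slopes[-> _].
  by rewrite [RHS](_ : _ = - a + - l * x w 0 0)//; ring.
- have [dl dlE] := lin b (- l) 1.
  apply: (etrans (near_eq_diff v _ d2 dl)); last by rewrite dlE.
  apply: filterS (nV _ Vu) => w /slopes[_ ->].
  by rewrite [RHS](_ : _ = b + - l * x w 0 1)//; ring.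
Qed.

(** * From umbilic points to saddles *)

(** Let [U i] be the largest open set in which [S] coincides with [G i].  These sets
    cover [S], and on [S] they are disjoint for distinct sets [G i]; so [S] meets
    only one of them by connectedness. *)
Lemma connected_germ_family {T : topologicalType} {I : Type} (G : I -> set T) (S : set T) :
  connected S ->
  (forall i j N q, open N -> N q -> G i q -> G i `&` N = G j `&` N -> G i = G j) ->
  (forall q, S q -> exists i N, [/\ open N, N q & S `&` N = G i `&` N]) ->
  S !=set0 -> exists i N, open N /\ S = G i `&` N.
Proof.
move=> Sconn Guniq Sloc [q0 Sq0].
have [i0 [N0 [N0o N0q0 SN0]]] := Sloc _ Sq0.
pose U i := \bigcup_(N in [set N | open N /\ S `&` N = G i `&` N]) N.
have Uo i : open (U i) by apply: bigcup_open => N [].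
have SU i q : U i q -> S q <-> G i q.
  move=> [N [_ SN] Nq]; split=> h.
    by have [] : (G i `&` N) q by rewrite -SN.
  by have [] : (S `&` N) q by rewrite SN.
exists i0, (U i0); split; first exact: Uo.
suff AS : S `&` U i0 = S.
  rewrite -{1}AS; apply/seteqP; split=> q [h Uq]; split=> //; exact/(SU _ _ Uq).
apply: Sconn.
- by exists q0; split=> //; exists N0.
- by exists (U i0).
- exists (~` \bigcup_(i in [set i | G i <> G i0]) U i).
    by apply: open_closedC; apply: bigcup_open.
  apply/seteqP; split=> q [Sq Uq]; split=> //.
    move=> [i /= Gi [N [No SN] Nq]]; apply: Gi.
    have [M [Mo SM] Mq] := Uq.
    apply: (Guniq _ _ (N `&` M) q) => //; first exact: openI.
      by apply/(SU i q) => //; exists N.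
    by rewrite setIA -SN setIA (setIC _ N) (setIC (G i0)) -[RHS]setIA -SM setIA (setIC N).
  have [i [N [No Nq SN]]] := Sloc _ Sq.
  have UNi : U i q by exists N.
  have [Gi|Gi] := pselect (G i = G i0); last by case: Uq; exists i.
  by exists N => //; split=> //; rewrite -Gi.
Qed.

Lemma diff_continuous_at_linear {R : realType} {V W W' : normedModType R}
    (x : V -> W) (L : {linear W -> W'}) (u : V) : continuous L ->
  (\forall w \near u, differentiable x w) ->
  diff_continuous_at x u -> diff_continuous_at (L \o x) u.
Proof.
move=> Lc dx xc e e0; have [k k0 Lk] := linear_lipschitz Lc.
have dL w : differentiable x w -> forall v, 'd (L \o x) w v = L ('d x w v).
  move=> dxw v; have dLx : differentiable L (x w) by exact: linear_differentiable.
  by rewrite diff_comp// diff_lin.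
have ek : 0 < e / k by rewrite divr_gt0.
have du := dL u (nbhs_singleton dx).
apply: filterS2 dx (xc _ ek) => w /dL dw H v.
rewrite (dw v) (du v) -linearB; apply: le_trans (Lk _) _.
by rewrite -ler_pdivlMl// mulrA [k^-1 * e]mulrC.
Qed.

Lemma partials_diff_continuous {R : realType} {W : normedModType R}
    (x : 'rV[R]_2 -> W) (u : 'rV[R]_2) :
  (\forall w \near u, differentiable x w) ->
  (forall i, {for u, continuous ('D_(delta_mx 0 i) x)}) ->
  diff_continuous_at x u.
Proof.
move=> dx Dc e e0; have e2 : 0 < e / 2 by rewrite divr_gt0.
have du := fun v => diff_row2 v (nbhs_singleton dx).
have near i : \forall w \near u, `|'D_(delta_mx 0 i) x w - 'D_(delta_mx 0 i) x u| <= e / 2.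
  have /cvgrPdist_le/(_ _ e2) := Dc i.
  by apply: filterS => w; rewrite distrC.
apply: filterS3 dx (near 0) (near 1) => w dw n0 n1 v.
have bound (a b a' b' : W) : `|a - a'| <= e / 2 -> `|b - b'| <= e / 2 ->
    `|v 0 0 *: a + v 0 1 *: b - (v 0 0 *: a' + v 0 1 *: b')| <= e * `|v|.
  move=> aa bb; rewrite opprD addrACA -!scalerBr.
  apply: le_trans (ler_normD _ _) _; rewrite !normrZ.
  have v0 := le_rV_norm v 0; have v1 := le_rV_norm v 1.
  have -> : e * `|v| = `|v| * (e / 2) + `|v| * (e / 2) by field.
  by rewrite lerD// ler_pM.
have dE := congr2 (fun a b : W => `|a - b|) (diff_row2 v dw) (du v).
by apply: le_trans (bound _ _ _ _ n0 n1); rewrite le_eqVlt; apply/orP; left; apply/eqP.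
Qed.

Section Local.
Context {R : realType}.
Variables (S : set 'rV[R]_3).
Hypothesis Sadm : admissible_surface S.
Hypothesis Sumb : totally_umbilical S.

(** With [psi] the local inverse of the projection of the chart [x], the height
    [z o psi] has first derivatives [- gauss1 o psi] and [gauss2 o psi], and
    umbilicity makes its Hessian [lam diag(1, -1)].  Conversely, points of the saddle
    near [q] lie on [S], because they lie above the image of the projection. *)
Lemma umbilical_locally_saddle (q : 'rV[R]_3) : S q ->
  exists l a b k (N : set 'rV[R]_3),
    [/\ open N, N q & S `&` N = saddle_graph l a b k `&` N].
Proof.
move=> Sq; have [V [x [xl [u0 Vu0 xu0]]]] := (Sadm.1 _ Sq).
have adm w : V w -> admissible_at x w by exact: (admissible_chart Sadm xl).
have [Vo _ _ _ xO] := xl.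
have VS w : V w -> S (x w).
  move=> Vw; have [M [_ VM]] := xO V Vo (fun _ h => h).
  have: (S `&` M) (x w) by rewrite -VM; exists w.
  by case.
have nV w : V w -> nbhs w V by move=> Vw; exact: open_nbhs_nbhs.
have dx w : V w -> differentiable x w by move=> /adm[].
pose F := hproj \o x.
have Fgood w : V w -> differentiable F w /\ injective ('d F w).
  move=> Vw; have [dF _] := is_diff_hproj (dx _ Vw).
  by split; [exact: dF|exact: admissible_proj_injective (adm _ Vw)].
have nF w : V w -> \forall z \near w, differentiable F z /\ injective ('d F z).
  by move=> Vw; apply: filterS (nV _ Vw) => z; exact: Fgood.
have Fc : diff_continuous_at F u0.
  have ndx : \forall w \near u0, differentiable x w.
    by apply: filterS (nV _ Vu0) => z; exact: dx.
  apply: (diff_continuous_at_linear (@hproj_continuous R) ndx).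
  apply: partials_diff_continuous => // i; apply: differentiable_continuous.
  by have [_ d _ _] := adm _ Vu0.
have [psi [psiF npsi]] := C1_local_inverse (nF _ Vu0) Fc (nV _ Vu0).
have [r r0 rB] := (nbhs_ballP _ _).1 npsi.
have lamP w : exists lam, V w -> forall v, 'd (gauss1 x) w v = - lam * 'd x w v 0 0 /\
             'd (gauss2 x) w v = - lam * 'd x w v 0 1.
  have [Vw|nVw] := pselect (V w); last by exists 0.
  have [lam H] := umbilic_gauss xl Vw (adm _ Vw) (Sumb (VS _ Vw)).
  by exists lam.
have [lam lamE] := choice lamP.
pose B := ball (F u0) r.
have psiV y : B y -> V (psi y) by move=> /rB[].
have dpsi y : B y -> differentiable psi y by move=> /rB[].
(* The chain rule for [F o psi = id]. *)
have projpsi y v : B y -> hproj ('d x (psi y) ('d psi y v)) = v.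
  move=> By; have [Vy Fy dy] := rB _ By.
  have [dF dFE] := is_diff_hproj (dx _ Vy).
  have nId : \forall z \near y, (F \o psi) z = id z.
    have : nbhs y B by apply: open_nbhs_nbhs; split; [exact: ball_open|].
    by apply: filterS => z /rB[].
  have idE := is_diff_id y.
  have idv : 'd id y v = v by rewrite (diff_val (is_diff_def := idE)).
  have E1 := congr1 (fun h : 'rV[R]_2 -> 'rV[R]_2 => h ('d psi y v)) dFE.
  have E2 := congr1 (fun h : 'rV[R]_2 -> 'rV[R]_2 => h v) (diff_comp dy dF).
  have E3 := near_eq_diff v nId (differentiable_comp dy dF) (ex_diff (is_diff_def := idE)).
  exact: etrans (esym E1) (etrans (esym E2) (etrans E3 idv)).
have comp (h : 'rV[R]_2 -> R) y : B y -> differentiable h (psi y) ->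
    is_diff y (h \o psi) (fun v => 'd h (psi y) ('d psi y v)).
  move=> By dh; split; first exact: differentiable_comp (dpsi _ By) dh.
  exact: diff_comp (dpsi _ By) dh.
have c0 y v : B y -> 'd x (psi y) ('d psi y v) 0 0 = v 0 0.
  by move=> By; rewrite -hproj0 projpsi.
have c1 y v : B y -> 'd x (psi y) ('d psi y v) 0 1 = v 0 1.
  by move=> By; rewrite -hproj1 projpsi.
have fd y : B y -> is_diff y ((fun w => x w 0 2) \o psi)
    (fun v => ((fun w => - gauss1 x w) \o psi) y * v 0 0 + (gauss2 x \o psi) y * v 0 1).
  move=> By; have Vy := psiV _ By.
  have [dh dhE] := comp _ _ By (differentiable_coordf 2 (dx _ Vy)).
  split; first exact: dh.
  apply: etrans dhE _; apply/funext => v.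
  apply: etrans (diff_coordf _ _ (dx _ Vy)) _.
  apply: etrans (diff_height _ (dx _ Vy) (admissible_minor (adm _ Vy))) _.
  by rewrite c0// c1.
have pd y : B y -> is_diff y ((fun w => - gauss1 x w) \o psi)
    (fun v => (lam \o psi) y * v 0 0).
  move=> By; have Vy := psiV _ By; have [d1 _] := admissible_gauss (adm _ Vy).
  have [dh dhE] := comp _ _ By (differentiableN d1).
  split; first exact: dh.
  apply: etrans dhE _; apply/funext => v.
  apply: etrans (congr1 (fun h : 'rV[R]_2 -> R => h ('d psi y v)) (diffN d1)) _.
  rewrite /= !fctE; have [-> _] := lamE _ Vy ('d psi y v).
  by rewrite c0// mulNr opprK.
have qd y : B y -> is_diff y (gauss2 x \o psi) (fun v => - (lam \o psi) y * v 0 1).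
  move=> By; have Vy := psiV _ By; have [_ d2] := admissible_gauss (adm _ Vy).
  have [dh dhE] := comp _ _ By d2.
  split; first exact: dh.
  apply: etrans dhE _; apply/funext => v.
  by have [_ ->] := lamE _ Vy ('d psi y v); rewrite c1.
have [l [a [b [k fE]]]] := diagonal_hessian_saddle fd pd qd.
have dFu0 : differentiable F u0 by have [] := Fgood _ Vu0.
have nB : \forall w \near u0, B (F w).
  by apply: (differentiable_continuous dFu0); exact: nbhsx_ballx.
have [s s0 sB] := (nbhs_ballP _ _).1 (filterI (filterI (nV _ Vu0) psiF) nB).
pose W := ball u0 s.
have Wo : open W by exact: ball_open.
have [M [Mo WM]] := xO W Wo (fun w Ww => (sB w Ww).1.1).
have [t t0 tB] := (nbhs_ballP _ _).1
  (diff_inj_nbhs_image (nF _ Vu0) (nbhsx_ballx u0 _ s0)).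
have xW w : W w -> x w 0 2 = saddle l a b k (F w).
  by move=> /sB[[_ psiw] Bw]; rewrite -fE//= psiw.
(* [M] cuts the image of [W] out of [S], and every point of the ball of radius [t]
   is the projection of a point of that image. *)
exists l, a, b, k, (M `&` hproj @^-1` ball (F u0) t); split.
- apply: openI => //; apply: open_comp; last exact: ball_open.
  by move=> z _; exact: hproj_continuous.
- split; last by rewrite /= -xu0; exact: ballxx.
  have : (S `&` M) (x u0) by rewrite -WM; exists u0 => //; exact: ballxx.
  by rewrite xu0 => -[].
apply/seteqP; split=> z [Hz [Mz Bz]]; split=> //.
  have : (S `&` M) z by [].
  by rewrite -WM => -[w Ww <-]; exact: xW.
have [w Ww Fw] := tB _ Bz.
have zx : z = x w.
  by apply: row3P; [exact: esym Fw|rewrite xW// Fw; exact: Hz].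
rewrite zx; have : (x @` W) (x w) by exists w.
by rewrite WM => -[].
Qed.

End Local.

(** * Saddle graphs, spheres of parabolic type and planes *)

Section Models.
Context {R : realType}.

(** Second differences at [p] determine [l], first differences then [a] and [b]. *)
Lemma saddle_germ_inj (l a b k l' a' b' k' : R) (p : 'rV[R]_2) :
  (\forall y \near p, saddle l a b k y = saddle l' a' b' k' y) ->
  [/\ l = l', a = a', b = b' & k = k'].
Proof.
move=> /nbhs_ballP[r /= r0 rB]; pose t := r / 2.
have t0 : t != 0 by rewrite gt_eqF// divr_gt0.
pose pt X Y : 'rV[R]_2 := \row_j (if j == 0 then p 0 0 + X else p 0 1 + Y).
have eqpt X Y : `|X| <= t -> `|Y| <= t ->
    saddle l a b k (pt X Y) = saddle l' a' b' k' (pt X Y).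
  move=> Xt Yt; apply: rB; rewrite -ball_normE /=.
  have tr : t < r by rewrite /t; lra.
  have [->|/rV_norm_attained[i <-]] := eqVneq (p - pt X Y) 0; first by rewrite normr0.
  apply: le_lt_trans tr; rewrite !mxE; have [->|i0] := eqVneq i 0.
    by rewrite opprD addNKr normrN.
  have -> : i = 1 by apply/val_inj; case: i i0 => [[|[|]]].
  by rewrite opprD addNKr normrN.
have tt : `|t| <= t by rewrite ger0_norm// /t divr_ge0// ltW.
have tn : `|- t| <= t by rewrite normrN.
have t00 : `|0 : R| <= t by rewrite normr0 (le_trans _ tt).
have := eqpt _ _ t00 t00; have := eqpt _ _ tt t00; have := eqpt _ _ tn t00.
have := eqpt _ _ t00 tt.
rewrite /saddle !mxE /= !addr0 => E1 E2 E3 E4.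
have lE : l = l'.
  have : (l - l') * t ^+ 2 = 0 by lra.
  by move=> /eqP; rewrite mulf_eq0 sqrf_eq0 (negPf t0) orbF subr_eq0 => /eqP.
rewrite lE in E1 E2 E3 E4.
have aE : a = a'.
  have : (a - a') * t = 0 by lra.
  by move=> /eqP; rewrite mulf_eq0 (negPf t0) orbF subr_eq0 => /eqP.
rewrite aE in E1 E2 E3 E4.
have bE : b = b'.
  have : (b - b') * t = 0 by lra.
  by move=> /eqP; rewrite mulf_eq0 (negPf t0) orbF subr_eq0 => /eqP.
by rewrite bE in E4; split=> //; lra.
Qed.

(** Points of the graph above a neighbourhood of [hproj q] stay in [N], so the two
    saddle functions agree there. *)
Lemma saddle_graph_germ (l a b k l' a' b' k' : R) (N : set 'rV[R]_3) (q : 'rV[R]_3) :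
  open N -> N q -> saddle_graph l a b k q ->
  saddle_graph l a b k `&` N = saddle_graph l' a' b' k' `&` N ->
  saddle_graph l a b k = saddle_graph l' a' b' k'.
Proof.
move=> No Nq Gq GN; pose g (y : 'rV[R]_2) := vec3 (y 0 0) (y 0 1) (saddle l a b k y).
have hg y : hproj (g y) = y.
  by apply: row2P; rewrite ?hproj0 ?hproj1 ?vec3_0 ?vec3_1.
have Ng : \forall y \near hproj q, N (g y).
  have /nbhs_ballP[e /= e0 eN] : nbhs q N by exact: open_nbhs_nbhs.
  have [ds _] := is_diff_saddle l a b k (hproj q).
  have /cvgrPdist_lt/(_ _ e0) := differentiable_continuous ds.
  apply: filterS2 (nbhsx_ballx (hproj q) _ e0) => y; rewrite -!ball_normE /= => qy sy.
  apply: eN; rewrite -ball_normE /=.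
  have [->|/rV_norm_attained[i <-]] := eqVneq (q - g y) 0; first by rewrite normr0.
  have [->|i0] := eqVneq i 0.
    by have := le_lt_trans (le_rV_norm _ 0) qy; rewrite !mxE -hproj0 mxE.
  have [->|i1] := eqVneq i 1.
    by have := le_lt_trans (le_rV_norm _ 1) qy; rewrite !mxE -hproj1 mxE.
  have -> : i = 2 by apply/val_inj; case: i i0 i1 => [[|[|[|]]]].
  by move: sy; rewrite -Gq !mxE.
have : \forall y \near hproj q, saddle l a b k y = saddle l' a' b' k' y.
  apply: filterS Ng => y Ngy.
  have : (saddle_graph l a b k `&` N) (g y) by split=> //; rewrite /saddle_graph /= hg vec3_2.
  by rewrite GN => -[]; rewrite /saddle_graph /= hg vec3_2.
by move=> /saddle_germ_inj[-> -> -> ->].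
Qed.

Lemma sum3 (F : 'I_3 -> R) : \sum_i F i = F 0 + F 1 + F 2.
Proof.
rewrite !big_ord_recl big_ord0 addr0 addrA.
by congr (_ + F _ + F _); apply: val_inj.
Qed.

Lemma saddle_graph_model (l a b k : R) :
  parabolic_sphere (saddle_graph l a b k) \/ non_isotropic_plane (saddle_graph l a b k).
Proof.
have [->|l0] := eqVneq l 0.
  right; split.
    exists (vec3 a b (-1)), (- k); split.
      apply/eqP => /(congr1 (fun v : 'rV[R]_3 => v 0 2)); rewrite vec3_2 mxE => /eqP.
      by rewrite oppr_eq0 oner_eq0.
    apply/seteqP; split=> q; rewrite /saddle_graph /saddle /= sum3 vec3_0 vec3_1 vec3_2
      hproj0 hproj1; lra.
  move=> [q qt]; have := qt 0; have := qt 1.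
  rewrite /saddle_graph /saddle /= !hproj0 !hproj1 !mxE /=; lra.
left; exists l^-1; rewrite invr_eq0; split=> //.
(* Shear and vertical translation suffice; [l^-1 / 2] compensates the constant
   [- p / 2] of the standard sphere. *)
exists 0, 0, (k + l^-1 / 2), a, b, 0.
have c0 : coshR (0 : R) = 1 by rewrite /coshR oppr0 expR0; field.
have s0 : sinhR (0 : R) = 0 by rewrite /sinhR oppr0 subrr mul0r.
apply/seteqP; split=> [q Gq|_ [q Sq <-]].
  exists (vec3 (q 0 0) (q 0 1) (q 0 2 - a * q 0 0 - b * q 0 1 - k - l^-1 / 2)).
    move: Gq; rewrite /saddle_graph /standard_parabolic_sphere /saddle /=.
    rewrite !vec3_0 !vec3_1 !vec3_2 !hproj0 !hproj1 => ->.
    by field; rewrite l0.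
  rewrite /rigid_motion c0 s0 !vec3_0 !vec3_1 !vec3_2.
  by apply: row3P; [apply: row2P|]; rewrite ?hproj0 ?hproj1 ?vec3_0 ?vec3_1 ?vec3_2; ring.
move: Sq; rewrite /saddle_graph /standard_parabolic_sphere /saddle /rigid_motion /=.
rewrite !hproj0 !hproj1 !vec3_0 !vec3_1 vec3_2.
by rewrite c0 s0 => ->; field; rewrite l0.
Qed.

Lemma coshR2_sinhR2 (phi : R) : coshR phi ^+ 2 - sinhR phi ^+ 2 = 1.
Proof.
have := expRxMexpNx_1 phi; rewrite /coshR /sinhR; move: (expR phi) (expR (- phi)) => x y xy.
by rewrite -[RHS]xy; field.
Qed.

Lemma parabolic_sphere_saddle (P : set 'rV[R]_3) : parabolic_sphere P ->
  exists l a b k, P `<=` saddle_graph l a b k.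
Proof.
move=> [p [p0 [A [B [c [c1 [c2 [phi ->]]]]]]]].
have CS := coshR2_sinhR2 phi; rewrite /rigid_motion.
move: (coshR phi) (sinhR phi) CS => C S CS.
exists p^-1, (- A / p + c1 * C - c2 * S), (B / p - c1 * S + c2 * C),
  ((A ^+ 2 - B ^+ 2) / (2 * p) - p / 2 + c - c1 * (A * C - B * S) - c2 * (B * C - A * S)).
move=> _ [q Sq <-].
rewrite /saddle_graph /saddle /= !hproj0 !hproj1 !vec3_0 !vec3_1 vec3_2.
move: Sq; rewrite /standard_parabolic_sphere /= => ->.
move: (q 0 0) (q 0 1) => x y.
(* The boost preserves [x^2 - y^2] and is inverted by exchanging the sign of [S];
   both use only [C^2 - S^2 = 1]. *)
transitivity (c - p / 2 +
  (c1 * x + c2 * y + (2 * p)^-1 * (x ^+ 2 - y ^+ 2)) * (C ^+ 2 - S ^+ 2)).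
  by rewrite CS; field.
by field.
Qed.

(** A normal vector without z-component would make the plane vertical. *)
Lemma non_isotropic_plane_saddle (P : set 'rV[R]_3) : non_isotropic_plane P ->
  exists l a b k, P `<=` saddle_graph l a b k.
Proof.
move=> [[n [d [n0 ->]]] niso].
have n2 : n 0 2 != 0.
  apply/eqP => n2; apply: niso; have [n00|n00] := eqVneq (n 0 0) 0; last first.
    exists (vec3 (d / n 0 0) 0 0) => t; rewrite /= sum3 !mxE /= n2; field.
    by rewrite n00.
  have [n01|n01] := eqVneq (n 0 1) 0; last first.
    exists (vec3 0 (d / n 0 1) 0) => t; rewrite /= sum3 !mxE /= n2; field.
    by rewrite n01.
  case/eqP: n0; apply: row3P; last by rewrite n2 mxE.
  by apply: row2P; rewrite ?hproj0 ?hproj1 ?mxE.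
exists 0, (- n 0 0 / n 0 2), (- n 0 1 / n 0 2), (d / n 0 2) => q.
rewrite /saddle_graph /saddle /= sum3 hproj0 hproj1 => <-; field.
by rewrite n2.
Qed.

End Models.

Theorem proposition4 (R : realType) (S : set 'rV[R]_3)
    (S_connected : connected S) (S_admissible : admissible_surface S) :
  totally_umbilical S <->
  exists P : set 'rV[R]_3,
    (parabolic_sphere P \/ non_isotropic_plane P) /\ open_part S P.
Proof.
split=> [Sumb|[P [PM [N [No SN]]]]]; last first.
  have [l [a [b [k PG]]]] : exists l a b k, P `<=` saddle_graph l a b k.
    by case: PM; [exact: parabolic_sphere_saddle|exact: non_isotropic_plane_saddle].
  apply: (saddle_umbilical S_admissible (l := l) (a := a) (b := b) (k := k)).
  by rewrite SN => q [/PG].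
(* The empty surface is an open part of every model. *)
have [->|S0] := eqVneq S set0.
  exists (saddle_graph 0 0 0 0); split; first exact: saddle_graph_model.
  by exists set0; split; [exact: open0|rewrite setI0].
pose G (i : R * R * R * R) := saddle_graph i.1.1.1 i.1.1.2 i.1.2 i.2.
have Guniq i j N q : open N -> N q -> G i q -> G i `&` N = G j `&` N -> G i = G j.
  exact: saddle_graph_germ.
have Gloc q : S q -> exists i N, [/\ open N, N q & S `&` N = G i `&` N].
  move=> /(umbilical_locally_saddle S_admissible Sumb)[l [a [b [k [N HN]]]]].
  by exists (l, a, b, k), N.
have [i [N [No SN]]] := connected_germ_family S_connected Guniq Gloc ((set0P S).1 S0).
by exists (G i); split; [exact: saddle_graph_model|exists N].
Qed.
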